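(* Let $B$ be a unital Banach algebra and let $A$ be a Banach algebra which is a subalgebra of $B$. If $A$ is not Arens regular, then the projective tensor product $A\hat{\otimes}B$ is not Arens regular.
   Context: For normed spaces $X,Y,Z$ and a bounded bilinear map $m:X\times Y\to Z$, define $m^*:Z^*\times X\to Y^*$ by $\langle m^*(z',x),y\rangle=\langle z',m(x,y)\rangle$; $m^{**}:Y^{**}\times Z^*\to X^*$ by $\langle m^{**}(y'',z'),x\rangle=\langle y'',m^*(z',x)\rangle$; $m^{***}:X^{**}\times Y^{**}\to Z^{**}$ by $\langle m^{***}(x'',y''),z'\rangle=\langle x'',m^{**}(y'',z')\rangle$. Let $m^t(y,x)=m(x,y)$ be the transpose of $m$; applying the construction to $m^t$ gives $m^{t***}:Y^{**}\times X^{**}\to Z^{**}$, whose transpose is $m^{t***t}:X^{**}\times Y^{**}\to Z^{**}$. The map $m$ is Arens regular if $m^{***}=m^{t***t}$. A Banach algebra is Arens regular if its multiplication is Arens regular as a bilinear map. The subalgebra $A$ carries the norm of $B$. $A\hat{\otimes}B$ is the completed projective tensor product, a Banach algebra with multiplication determined by $(a\otimes b)(a_1\otimes b_1)=aa_1\otimes bb_1$. *)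

(* Defs.v *)
From HB Require Import structures.
From mathcomp Require Import all_boot all_order all_algebra.
From mathcomp Require Import all_classical all_reals all_analysis.
From mathcomp Require Import complex.

Set Implicit Arguments.
Unset Strict Implicit.
Unset Printing Implicit Defensive.

Import Order.TTheory GRing.Theory Num.Theory.
Import numFieldNormedType.Exports.

Local Open Scope classical_set_scope.
Local Open Scope ring_scope.

(* The scalar field is either the field of real numbers or the field of
   complex numbers, over any model R of the real numbers. *)
Variant scalars := RealScalars of realType | ComplexScalars of realType.

Definition scalar_field (F : scalars) : numFieldType :=
  match F with
  | RealScalars R => R
  | ComplexScalars R => R[i]%C
  end.
Coercion scalar_field : scalars >-> numFieldType.

(* The norm of a normedModType over R[i] takes its values in R[i] and is a
   nonnegative (hence real) element there, so suprema of sets of norms are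
   taken for the order of R[i]. *)
Lemma scalar_supremums (F : scalars) (E : set F) :
  (forall x, E x -> 0 <= x) -> E !=set0 -> ubound E !=set0 ->
  supremums E !=set0.
Proof.
case: F E => R E /= E0 [x Ex] [M EM].
  have hE : has_sup E by split; [exists x|exists M].
  exists (sup E); split; first exact/ubP/sup_upper_bound.
  by move=> y; apply: ge_sup; exists x.
pose D := [set complex.Re z | z in E].
have hD : has_sup D.
  split; first by exists (complex.Re x), x.
  exists (complex.Re M) => _ [z Ez <-]; move: (EM z Ez).
  by rewrite lecE => /andP[].
have ImE z : E z -> complex.Im z = 0.
  by move=> /E0; rewrite lecE => /andP[/eqP].
exists ((sup D)%:C)%C; split.
  move=> z Ez; rewrite lecE /= (ImE _ Ez) eqxx/=.
  by apply: (sup_upper_bound hD); exists z.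
move=> y Ey; rewrite lecE /=.
have := Ey _ Ex; rewrite lecE (ImE _ Ex) => /andP[-> _] /=.
apply: ge_sup; first by exists (complex.Re x), x.
by move=> _ [z Ez <-]; have := Ey _ Ez; rewrite lecE => /andP[].
Qed.

Section Dual.
Variables (F : scalars) (X : normedModType F).

Definition dual_pred : {pred X -> F^o} :=
  [pred f : X -> F^o | `[< linear f /\ continuous f >]].

Record dual := Dual {dual_fun :> X -> F^o; dual_funP : dual_fun \in dual_pred}.

HB.instance Definition _ := [isSub for dual_fun].
HB.instance Definition _ := [Choice of dual by <:].

Lemma dual_submod_closed : submod_closed dual_pred.
Proof.
split.
  apply/asboolP; split; last by move=> x; exact: cvg_cst.
  by move=> a x y; rewrite /= scaler0 addr0.
move=> a f g /asboolP[lf cf] /asboolP[lg cg].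
apply/asboolP; split.
  move=> b x y; rewrite !fctE lf lg.
  by rewrite !scalerDr !scalerA addrACA [a * b]mulrC.
by move=> x; apply: cvgD; [apply: cvgZr; exact: cf|exact: cg].
Qed.

HB.instance Definition _ :=
  GRing.isSubmodClosed.Build F (X -> F^o) dual_pred dual_submod_closed.
HB.instance Definition _ := [SubChoice_isSubLmodule of dual by <:].

Definition opnorm (f : dual) : F :=
  supremum 0 [set `|f x| | x in [set x | `|x| <= 1]].

Lemma dual_linear (f : dual) : linear f.
Proof. by case: f => f /= /asboolP[]. Qed.

HB.instance Definition _ (f : dual) :=
  GRing.isLinear.Build F X F^o _ f (dual_linear f).

Lemma dual_continuous (f : dual) : continuous f.
Proof. by case: f => f /= /asboolP[]. Qed.

Lemma dual_bounded (f : dual) :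
  exists2 M : F, 0 < M & forall x, `|f x| <= M * `|x|.
Proof.
have /linear_bounded_continuous/linear_boundedP := @dual_continuous f.
by move=> /pinfty_ex_gt0[M M0 fM]; exists M.
Qed.

Lemma opnorm_supremums (f : dual) :
  supremums [set `|f x| | x in [set x | `|x| <= 1]] (opnorm f).
Proof.
set E := [set _ | _ in _].
have E0 : E `|f 0| by exists 0 => //=; rewrite normr0.
have : supremums E !=set0.
  apply: scalar_supremums; first by move=> _ [x _ <-].
    by exists `|f 0|.
  have [M M0 fM] := dual_bounded f; exists M => _ [x /= x1 <-].
  by rewrite (le_trans (fM x))// ler_piMr// ltW.
move=> [s Es]; rewrite /opnorm /supremum ifF; last first.
  by apply/negP => /eqP E00; move: E0; rewrite /E E00.
exact: (xgetPex 0 (ex_intro _ s Es)).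
Qed.

Lemma opnorm_ge0 (f : dual) : 0 <= opnorm f.
Proof.
have [ubE _] := opnorm_supremums f.
by rewrite (le_trans _ (ubE `|f 0| _))//; exists 0 => //=; rewrite normr0.
Qed.

Lemma opnormP (f : dual) x : `|f x| <= opnorm f * `|x|.
Proof.
have [->|x0] := eqVneq x 0; first by rewrite linear0 !normr0 mulr0.
have [ubE _] := opnorm_supremums f.
have nx0 : 0 < `|x| by rewrite normr_gt0.
have /ubE : [set `|f x| | x in [set x | `|x| <= 1]] `|f (`|x|^-1 *: x)|.
  exists (`|x|^-1 *: x) => //=.
  by rewrite normrZ normfV normr_id mulVf// gt_eqF.
by rewrite linearZ normrZ normfV normr_id ler_pdivrMl// mulrC.
Qed.

Lemma opnorm_le (f : dual) (M : F) :
  0 <= M -> (forall x, `|f x| <= M * `|x|) -> opnorm f <= M.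
Proof.
move=> M0 fM; have [_] := opnorm_supremums f; apply => _ [x /= x1 <-].
by rewrite (le_trans (fM x))// ler_piMr.
Qed.

Lemma ler_opnormD (f g : dual) : opnorm (f + g) <= opnorm f + opnorm g.
Proof.
apply: opnorm_le => [|x]; first by rewrite addr_ge0 ?opnorm_ge0.
rewrite mulrDl (le_trans (ler_normD (f x) (g x)))//.
by rewrite lerD ?opnormP.
Qed.

Lemma opnorm_leZ (a : F) (f : dual) : opnorm (a *: f) <= `|a| * opnorm f.
Proof.
apply: opnorm_le => [|x]; first by rewrite mulr_ge0 ?opnorm_ge0.
by rewrite (normrZ a (f x)) -mulrA ler_wpM2l ?opnormP.
Qed.

Lemma opnormZ (a : F) (f : dual) : opnorm (a *: f) = `|a| * opnorm f.
Proof.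
apply/eqP; rewrite eq_le opnorm_leZ/=.
have [->|a0] := eqVneq a 0; first by rewrite normr0 mul0r opnorm_ge0.
rewrite -ler_pdivlMl ?normr_gt0// -normfV.
by rewrite (le_trans _ (opnorm_leZ _ _))// scalerA mulVf// scale1r.
Qed.

Lemma opnorm0_eq0 (f : dual) : opnorm f = 0 -> f = 0.
Proof.
move=> f0; apply: val_inj; apply/funext => x.
by apply/eqP; rewrite -normr_le0 (le_trans (opnormP f x))// f0 mul0r.
Qed.

HB.instance Definition _ :=
  Lmodule_isNormed.Build F dual ler_opnormD opnormZ opnorm0_eq0.

End Dual.

Record bbilinear (F : scalars) (X Y Z : normedModType F) := BBilinear {
  bbilinear_fun :> {bilinear X -> Y -> Z};
  bbilinear_bounded :
    exists M : F, forall x y, `|bbilinear_fun x y| <= M * `|x| * `|y| }.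

Lemma bbilinear_boundedW (F : scalars) (X Y Z : normedModType F)
    (m : bbilinear X Y Z) :
  exists2 M : F, 0 <= M & forall x y, `|m x y| <= M * `|x| * `|y|.
Proof.
have [M mM] := bbilinear_bounded m; exists `|M| => // x y.
have := mM x y; rewrite -!mulrA => mMxy.
have /ger0_norm <- : 0 <= `|m x y| by [].
rewrite -[leRHS](_ : `|M * (`|x| * `|y|)| = _); last first.
  by rewrite !normrM !normr_id.
by rewrite normr_id (le_trans mMxy)// ger0_norm// (le_trans _ mMxy).
Qed.

Section Transpose.
Variables (F : scalars) (X Y Z : normedModType F) (m : bbilinear X Y Z).

Definition transpose_fun (y : Y) (x : X) : Z := m x y.

Lemma transpose_bilinear :
  bilinear_for (GRing.Scale.Law.clone _ _ *:%R _)
    (GRing.Scale.Law.clone _ _ *:%R _) transpose_fun.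
Proof. by split=> u a x y; [exact: linearPr|exact: linearPl]. Qed.

HB.instance Definition _ :=
  bilinear_isBilinear.Build F Y X Z _ _ transpose_fun transpose_bilinear.

Lemma transpose_bounded :
  exists M : F, forall y x, `|transpose_fun y x| <= M * `|y| * `|x|.
Proof.
by have [M mM] := bbilinear_bounded m; exists M => y x; rewrite mulrAC; exact: mM.
Qed.

Definition transpose : bbilinear Y X Z := BBilinear transpose_bounded.

End Transpose.

Section Adjoint.
Variables (F : scalars) (X Y Z : normedModType F) (m : bbilinear X Y Z).

Lemma adjoint_subproof (z' : dual Z) (x : X) :
  (fun y => z' (m x y)) \in @dual_pred F Y.
Proof.
have l : linear (fun y => z' (m x y) : F^o).
  by move=> a u v; rewrite linearPr linearP.
pose g := HB.pack_for {linear Y -> F^o} (fun y => z' (m x y) : F^o)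
  (GRing.isLinear.Build F Y F^o _ _ l).
apply/asboolP; split => //.
apply: (@linear_bounded_continuous F Y F^o g).1.
have [M M0 mM] := bbilinear_boundedW m.
apply/linear_boundedP; exists (opnorm z' * (M * `|x|)); split.
  by rewrite ger0_real// !mulr_ge0// opnorm_ge0.
move=> r /ltW lr y /=; apply: (le_trans (opnormP _ _)).
rewrite (le_trans (ler_wpM2l (opnorm_ge0 _) (mM x y)))//.
by rewrite mulrA ler_wpM2r.
Qed.

(* <m^*(z', x), y> = <z', m(x, y)> *)
Definition adjoint_fun (z' : dual Z) (x : X) : dual Y :=
  Dual (adjoint_subproof z' x).

Lemma adjoint_bilinear :
  bilinear_for (GRing.Scale.Law.clone _ _ *:%R _)
    (GRing.Scale.Law.clone _ _ *:%R _) adjoint_fun.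
Proof.
split=> [x a z' t'|z' a x t]; apply: val_inj; apply/funext => y //=.
by rewrite linearPl linearP.
Qed.

HB.instance Definition _ :=
  bilinear_isBilinear.Build F (dual Z) X (dual Y) _ _ adjoint_fun
    adjoint_bilinear.

Lemma adjoint_bounded :
  exists M : F, forall z' x, `|adjoint_fun z' x| <= M * `|z'| * `|x|.
Proof.
have [M M0 mM] := bbilinear_boundedW m; exists M => z' x.
apply: opnorm_le => [|y]; first by rewrite !mulr_ge0.
rewrite (le_trans (opnormP z' (m x y)))//.
rewrite (le_trans (ler_wpM2l (opnorm_ge0 _) (mM x y)))//.
by rewrite !mulrA [opnorm z' * M]mulrC.
Qed.

Definition adjoint : bbilinear (dual Z) X (dual Y) :=
  BBilinear adjoint_bounded.

End Adjoint.

Definition triadjoint (F : scalars) (X Y Z : normedModType F)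
    (m : bbilinear X Y Z) :
  bbilinear (dual (dual X)) (dual (dual Y)) (dual (dual Z)) :=
  adjoint (adjoint (adjoint m)).

Definition arens_regular_map (F : scalars) (X Y Z : normedModType F)
    (m : bbilinear X Y Z) : Prop :=
  forall (x'' : dual (dual X)) (y'' : dual (dual Y)),
    triadjoint m x'' y'' = transpose (triadjoint (transpose m)) x'' y''.

(* Banach algebras are not required to have a unit. *)
HB.mixin Record isBanachAlgebra (F : scalars) A
    & CompleteNormedModule F A := {
  bmul : A -> A -> A;
  bmulA : associative bmul;
  bmulDl : left_distributive bmul +%R;
  bmulDr : right_distributive bmul +%R;
  bmulZl : forall (k : F) a b, bmul (k *: a) b = k *: bmul a b;
  bmulZr : forall (k : F) a b, bmul a (k *: b) = k *: bmul a b;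
  bmul_norm : forall a b, `|bmul a b| <= `|a| * `|b|
}.

#[short(type="banachAlgType")]
HB.structure Definition BanachAlgebra (F : scalars) :=
  {A of CompleteNormedModule F A & isBanachAlgebra F A}.

Section BanachAlgebraTheory.
Variables (F : scalars) (A : banachAlgType F).

Lemma bmul_bilinear :
  bilinear_for (GRing.Scale.Law.clone _ _ *:%R _)
    (GRing.Scale.Law.clone _ _ *:%R _) (@bmul F A).
Proof.
by split=> u a x y; rewrite ?bmulDl ?bmulDr ?bmulZl ?bmulZr.
Qed.

HB.instance Definition _ :=
  bilinear_isBilinear.Build F A A A _ _ (@bmul F A) bmul_bilinear.

Lemma bmul_bounded :
  exists M : F, forall a b : A, `|bmul a b| <= M * `|a| * `|b|.
Proof. by exists 1 => a b; rewrite mul1r bmul_norm. Qed.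

Definition bmul_bbilinear : bbilinear A A A := BBilinear bmul_bounded.

Definition arens_regular : Prop := arens_regular_map bmul_bbilinear.

Definition unital : Prop :=
  exists e : A, forall a, bmul e a = a /\ bmul a e = a.

End BanachAlgebraTheory.

(* A is identified with its image under the embedding iota. *)
Definition subalgebra_embedding (F : scalars) (A B : banachAlgType F)
    (iota : {linear A -> B}) : Prop :=
  (forall a b, iota (bmul a b) = bmul (iota a) (iota b)) /\
  (forall a, `|iota a| = `|a|).

Section ProjectiveTensor.
Variables (F : scalars) (A B : banachAlgType F).

(* The value in V of the formal sum of elementary tensors a (x) b,
   (a, b) \in s; its scalar coefficients are absorbed by the vectors a. *)
Definition tensor_sum (V : lmodType F) (f : A -> B -> V) (s : seq (A * B)) : V :=
  \sum_(p <- s) f p.1 p.2.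

Definition tensor_cost (s : seq (A * B)) : F := \sum_(p <- s) `|p.1| * `|p.2|.

(* T, with (a, b) |-> tau a b for the elementary tensors, is a completed
   projective tensor product of A and B:
   - the linear span of the elementary tensors is the algebraic tensor product
     of A and B, i.e. every bilinear map factors through it;
   - the norm of T on this span is the projective norm
     `|u| = inf {\sum_i `|a_i| * `|b_i| | u = \sum_i a_i (x) b_i};
   - T, which is complete, is a completion of this span;
   - elementary tensors are multiplied componentwise. *)
Record is_projective_tensor (T : banachAlgType F) (tau : {bilinear A -> B -> T}) :
    Prop := {
  ptensor_algebraic : forall (V : lmodType F) (f : {bilinear A -> B -> V}) s,
    tensor_sum tau s = 0 -> tensor_sum f s = 0;
  ptensor_norm : forall u, range (tensor_sum tau) u ->
    infimums [set tensor_cost s | s in [set s | tensor_sum tau s = u]] `|u|;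
  ptensor_dense : dense (range (tensor_sum tau));
  ptensor_mul : forall a b a1 b1,
    bmul (tau a b) (tau a1 b1) = tau (bmul a a1) (bmul b b1) }.

End ProjectiveTensor.

(* Main.v *)
From HB Require Import structures.
Require Import Defs.
From mathcomp Require Import all_boot all_order all_algebra.
From mathcomp Require Import all_classical all_reals all_analysis.
From mathcomp Require Import complex ring lra.

Set Implicit Arguments.
Unset Strict Implicit.
Unset Printing Implicit Defensive.

Import Order.TTheory GRing.Theory Num.Theory.
Import numFieldNormedType.Exports.

Local Open Scope classical_set_scope.
Local Open Scope ring_scope.

(** Let e be the unit of B.  The map phi : a |-> a (x) e is a bounded algebra
    homomorphism from A to T, and the subalgebra structure makes it bounded
    below: (a, b) |-> iota a * b is a contractive bilinear map from A x B to B,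
    so it factors through a contraction on the span of the elementary tensors
    ([elementary_tensor_lower_bound]), which sends a (x) e to iota a.  Hence
    the norm of a is at most the norm of a (x) e.

    Arens regularity is inherited along such a phi
    ([arens_regular_embedding]).  The triple adjoint is natural
    ([triadjoint_natural]), so regularity of T makes the two Arens products on
    the bidual of A agree after applying the second adjoint of phi, that is, on
    every functional of the form g o phi.  As phi is bounded below, the
    Hahn-Banach theorem ([dual_extension]) says that these are all the
    functionals on A.

    The Hahn-Banach theorem is obtained from Zorn's lemma applied to sublinear
    functions rather than to partial extensions: a minimal sublinear function
    is linear ([minimal_sublinear_linear]), and a sublinear function can be
    lowered so that every linear function below it agrees with a prescribed
    dominated functional ([sublinear_push]).  Complex scalars reduce to real ones by
    extending the real part. *)

(** * Hahn-Banach theorem for real vector spaces *)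

Section Sublinear.
Variables (R : realType) (V : lmodType R).
Implicit Types (p q r : V -> R) (C : set (V * R)).

Definition sublinear q :=
  (forall x y, q (x + y) <= q x + q y) /\
  (forall t x, 0 < t -> q (t *: x) = t * q x).

Lemma sublinear0 q : sublinear q -> q 0 = 0.
Proof.
move=> [_ qZ]; have := qZ 2 0 (ltr0Sn _ 1); rewrite scaler0 => ?; lra.
Qed.

Lemma sublinear_opp_ge q x : sublinear q -> - q (- x) <= q x.
Proof.
move=> qs; have := qs.1 x (- x); rewrite subrr (sublinear0 qs) => ?; lra.
Qed.

Lemma inf_le_scale (E E' : set R) (t : R) : 0 < t -> E !=set0 ->
  has_lbound E' -> (forall e, E e -> E' (t * e)) -> inf E' <= t * inf E.
Proof.
move=> t0 E0 lE' EE'; rewrite -ler_pdivrMl//; apply: lb_le_inf => // e Ee.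
by rewrite ler_pdivrMl//; apply: ge_inf => //; exact: EE'.
Qed.

Lemma inf_homogeneous (E : V -> set R) :
  (forall x, E x !=set0 /\ has_lbound (E x)) ->
  (forall t x e, 0 < t -> E x e -> E (t *: x) (t * e)) ->
  forall t x, 0 < t -> inf (E (t *: x)) = t * inf (E x).
Proof.
move=> Einf EZ t x t0; apply/eqP; rewrite eq_le; apply/andP; split.
  apply: inf_le_scale => //; [exact: (Einf x).1|exact: (Einf _).2|].
  by move=> e; exact: EZ.
rewrite -ler_pdivlMl//; apply: inf_le_scale; rewrite ?invr_gt0//.
- exact: (Einf _).1.
- exact: (Einf _).2.
- move=> e /(EZ t^-1); rewrite invr_gt0 scalerA mulVf ?gt_eqF// scale1r.
  exact.
Qed.

(** The witness is the infimum of q (x + v) - c over the pairs (v, c) of C.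
    It is sublinear because C is a convex cone, and finite because c <= q v on
    C.  Taking for C the graph of a dominated linear functional h forces every
    linear function below the witness to agree with h; taking for C the ray
    through (y, q y) is what shows that minimal sublinear functions are odd. *)
Lemma sublinear_push q C : sublinear q -> C (0, 0) ->
  (forall u v, C u -> C v -> C (u.1 + v.1, u.2 + v.2)) ->
  (forall t u, 0 < t -> C u -> C (t *: u.1, t * u.2)) ->
  (forall u, C u -> u.2 <= q u.1) ->
  exists r, [/\ sublinear r, forall x, r x <= q x &
    forall u, C u -> r (- u.1) <= - u.2].
Proof.
move=> qs C0 CD CZ Cq.
pose E x := [set q (x + u.1) - u.2 | u in C].
have Einf x : E x !=set0 /\ has_lbound (E x).
  split; first by exists (q (x + 0) - 0), (0, 0).
  exists (- q (- x)) => _ [u Cu <-]; have := qs.1 (x + u.1) (- x).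
  rewrite addrAC subrr add0r; have := Cq u Cu => ? ?; lra.
exists (fun x => inf (E x)); split; first split.
- move=> x y /=; rewrite -lerBlDr; apply: lb_le_inf => [|_ [u Cu <-]].
    exact: (Einf x).1.
  rewrite lerBlDr -lerBlDl; apply: lb_le_inf => [|_ [v Cv <-]].
    exact: (Einf y).1.
  rewrite lerBlDl (@le_trans _ _ (q (x + y + (u.1 + v.1)) - (u.2 + v.2)))//.
    by apply: ge_inf; [exact: (Einf _).2|exists (u.1 + v.1, u.2 + v.2) => //; exact: CD].
  have := qs.1 (x + u.1) (y + v.1); rewrite addrACA => ?; lra.
- apply: inf_homogeneous => // t x _ t0 [u Cu <-].
  exists (t *: u.1, t * u.2); first exact: CZ.
  by rewrite /= -scalerDr qs.2// mulrBr.
- move=> x; apply: ge_inf; first exact: (Einf x).2.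
  by exists (0, 0) => //=; rewrite addr0 subr0.
- move=> u Cu; apply: ge_inf; first exact: (Einf _).2.
  by exists u => //; rewrite addNr (sublinear0 qs) sub0r.
Qed.

(** The pointwise infimum of a chain of sublinear functions below p is finite,
    being at least - p (- x), and subadditive, since two members of the chain
    can be replaced by the smaller one. *)
Lemma minimal_sublinear p : sublinear p ->
  exists q, [/\ sublinear q, forall x, q x <= p x &
    forall r, sublinear r -> (forall x, r x <= q x) -> forall x, q x <= r x].
Proof.
move=> ps; pose S q := sublinear q /\ forall x, q x <= p x.
(* The order is reversed: maximal elements for le are minimal functions. *)
pose le (q r : {q | S q}) := `[< forall x, sval r x <= sval q x >].
have Sp : S p by [].
have [| | |[q [qs qp]] qmin] := @ZL_preorder _ (exist S p Sp) le.
- by move=> q; exact/asboolP.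
- move=> q r s /asboolP rq /asboolP qs; apply/asboolP => x.
  exact: le_trans (qs x) (rq x).
- move=> A Atot; have [[q0 Aq0]|A0] := pselect (A !=set0); last first.
    by exists (exist S p Sp) => q Aq; exfalso; apply: A0; exists q.
  pose E x := [set sval q x | q in A].
  have Einf x : E x !=set0 /\ has_lbound (E x).
    split; first by exists (sval q0 x), q0.
    exists (- p (- x)) => _ [[q [qs qp]] _ <-] /=.
    have := sublinear_opp_ge x qs; have := qp (- x) => ? ?; lra.
  have lS : S (fun x => inf (E x)).
    split; last first.
      move=> x; apply: le_trans ((svalP q0).2 x).
      by apply: ge_inf; [exact: (Einf x).2|exists q0].
    split; last first.
      apply: inf_homogeneous => // t x _ t0 [q Aq <-].
      by exists q => //; rewrite (svalP q).1.2.
    move=> x y /=; rewrite -lerBlDr; apply: lb_le_inf => [|_ [q Aq <-]].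
      exact: (Einf x).1.
    rewrite lerBlDr -lerBlDl; apply: lb_le_inf => [|_ [r Ar <-]].
      exact: (Einf y).1.
    rewrite lerBlDl.
    have [m [Am mq mr]] : exists m, [/\ A m, sval m x <= sval q x &
        sval m y <= sval r y].
      by have [/asboolP qr|/asboolP rq] := Atot q r Aq Ar; [exists r|exists q].
    have /le_trans : inf (E (x + y)) <= sval m (x + y).
      by apply: ge_inf; [exact: (Einf _).2|exists m].
    by apply; have := (svalP m).1.1 x y => ?; lra.
  exists (exist S _ lS) => q Aq; apply/asboolP => x /=.
  by apply: ge_inf; [exact: (Einf x).2|exists q].
- exists q; split=> // r rs rq.
  have rS : S r by split => // x; exact: le_trans (rq x) (qp x).
  by have /(_ _)/asboolP := qmin (exist S r rS); apply; exact/asboolP.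
Qed.

(** Pushing q down along the ray through (y, q y) changes nothing by
    minimality, so q (- y) <= - q y; an odd subadditive function is additive. *)
Lemma minimal_sublinear_linear q : sublinear q ->
  (forall r, sublinear r -> (forall x, r x <= q x) -> forall x, q x <= r x) ->
  linear (q : V -> R^o).
Proof.
move=> qs qmin.
have qN y : q (- y) = - q y.
  pose C : set (V * R) := [set (t *: y, t * q y) | t in [set t | 0 <= t]].
  have [||||r [rs rq rC]] := @sublinear_push q C qs.
  - by exists 0 => //=; rewrite scale0r mul0r.
  - move=> _ _ [s /= s0 <-] [t /= t0 <-]; exists (s + t) => /=.
      exact: addr_ge0.
    by rewrite scalerDl mulrDl.
  - move=> s _ s0 [t /= t0 <-]; exists (s * t) => /=; last by rewrite scalerA mulrA.
    by rewrite mulr_ge0// ltW.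
  - move=> _ [t /= t0 <-] /=; move: t0; rewrite le_eqVlt => /predU1P[<-|t0].
      by rewrite scale0r mul0r (sublinear0 qs).
    by rewrite qs.2.
  apply/eqP; rewrite eq_le; apply/andP; split.
    apply: (le_trans (qmin r rs rq _)).
    by apply: (rC (y, q y)); exists 1 => //=; rewrite scale1r mul1r.
  have := sublinear_opp_ge (- y) qs; rewrite opprK; exact.
have qD x y : q (x + y) = q x + q y.
  apply/eqP; rewrite eq_le qs.1 /=; have := qs.1 (x + y) (- y).
  rewrite addrK qN => ?; lra.
move=> t x y; rewrite qD; congr (_ + _).
have [t0|t0|->] := ltgtP t 0; last by rewrite !scale0r (sublinear0 qs).
  by rewrite -[t]opprK scaleNr qN qs.2 ?oppr_gt0// scaleNr.
by rewrite qs.2.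
Qed.

(** The functional h is defined on a space W mapped to V by j, rather than on a
    subspace of V; the domination makes h vanish on the kernel of j. *)
Theorem hahn_banach_real (W : lmodType R) (j : {linear W -> V})
    (h : {linear W -> R^o}) p : sublinear p -> (forall w, h w <= p (j w)) ->
  exists u : {linear V -> R^o}, (forall x, u x <= p x) /\
    (forall w, u (j w) = h w).
Proof.
move=> ps hp; pose C : set (V * R) := range (fun w => (j w, h w)).
have [||||r [rs rp rC]] := @sublinear_push p C ps.
- by exists 0 => //; rewrite !linear0.
- by move=> _ _ [w _ <-] [w' _ <-]; exists (w + w') => //; rewrite !linearD.
- by move=> t _ _ [w _ <-]; exists (t *: w) => //; rewrite !linearZ.
- by move=> _ [w _ <-]; exact: hp.
have [q [qs qr qmin]] := minimal_sublinear rs.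
have ql := minimal_sublinear_linear qs qmin.
pose u := HB.pack_for {linear V -> R^o} (q : V -> R^o)
  (GRing.isLinear.Build R V R^o _ _ ql).
have uE x : u x = q x by [].
(* Applied to - w, this one inequality also gives the converse one. *)
have hu w : h w <= u (j w).
  rewrite -[h w]opprK lerNl -linearN uE (le_trans (qr _))//.
  by apply: (rC (j w, h w)); exists w.
exists u; split=> [x|w]; first exact: le_trans (qr x) (rp x).
apply/eqP; rewrite eq_le hu andbT.
by have := hu (- w); rewrite !linearN lerN2.
Qed.

End Sublinear.

(** * Norm-bounded functionals over real and complex scalars *)

Lemma bounded_linear_dual (F : scalars) (X : normedModType F) (g : X -> F^o)
    (M : F) : linear g -> 0 <= M -> (forall x, `|g x| <= M * `|x|) ->
  g \in @dual_pred F X.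
Proof.
move=> gl M0 gM; apply/asboolP; split=> //.
pose u := HB.pack_for {linear X -> F^o} g (GRing.isLinear.Build F X F^o _ g gl).
apply: (@linear_bounded_continuous F X F^o u).1.
apply/linear_boundedP; exists M; split; first exact: ger0_real.
by move=> r /ltW Mr x; rewrite (le_trans (gM x))// ler_wpM2r.
Qed.

(** An alias, so that V can carry its real vector space structure next to the
    complex one. *)
Definition realified (R : realType) (V : lmodType R[i]) : Type := V.

Section Realified.
Variables (R : realType) (V : lmodType R[i]).

HB.instance Definition _ := GRing.Zmodule.on (realified V).

Definition realified_scale (t : R) (x : realified V) : realified V :=
  (t%:C)%C *: (x : V).

Fact realified_scaleA a b x :
  realified_scale a (realified_scale b x) = realified_scale (a * b) x.
Proof. by rewrite /realified_scale scalerA rmorphM. Qed.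

Fact realified_scale1 : left_id 1 realified_scale.
Proof. by move=> x; rewrite /realified_scale rmorph1 scale1r. Qed.

Fact realified_scaleDr : right_distributive realified_scale +%R.
Proof. by move=> t x y; exact: scalerDr. Qed.

Fact realified_scaleDl x : {morph realified_scale^~ x : a b / a + b}.
Proof. by move=> a b; rewrite /realified_scale rmorphD scalerDl. Qed.

HB.instance Definition _ := GRing.Zmodule_isLmodule.Build R (realified V)
  realified_scaleA realified_scale1 realified_scaleDr realified_scaleDl.

End Realified.

Lemma norm_sublinear_real (R : realType) (X : normedModType R) (M : R) :
  0 <= M -> sublinear (fun x : X => M * `|x|).
Proof.
move=> M0; split=> [x y|t x t0].
  by rewrite -mulrDr ler_wpM2l// ler_normD.
by rewrite normrZ gtr0_norm// mulrCA.
Qed.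

Lemma norm_sublinear_complex (R : realType) (X : normedModType R[i]) (M : R) :
  0 <= M -> sublinear (fun x : realified X => M * complex.Re `|x : X|).
Proof.
move=> M0; split=> [x y|t x t0].
  have := ler_normD (x : X) y; rewrite lecE => /andP[_].
  by rewrite raddfD /= -mulrDr => ?; rewrite ler_wpM2l.
rewrite /= /GRing.scale /= /realified_scale normrZ normc_def /= expr0n addr0.
rewrite sqrtr_sqr gtr0_norm//; case: `|_ : X| => a b /=.
by rewrite mul0r subr0 mulrCA.
Qed.

Lemma dual_extension_real (R : realType)
    (X Y : normedModType (RealScalars R)) (phi : {linear X -> Y}) :
  (forall x, `|x| <= `|phi x|) ->
  forall f : dual X, exists g : dual Y, forall x, g (phi x) = f x.
Proof.
move=> phi1 f; have f0 : (0 : R) <= opnorm f := opnorm_ge0 f.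
have [|u [up uphi]] := @hahn_banach_real R Y X phi (f : {linear X -> R^o})
  (fun y => opnorm f * `|y|) (norm_sublinear_real Y f0).
  move=> x /=; rewrite (le_trans (ler_norm _))// (le_trans (opnormP f x))//.
  by rewrite ler_wpM2l.
have uM y : `|u y| <= opnorm f * `|y|.
  by rewrite ler_norml up andbT lerNl -linearN (le_trans (up _))// normrN.
have gP : (u : Y -> _) \in @dual_pred (RealScalars R) Y.
  exact: (@bounded_linear_dual (RealScalars R) Y u (opnorm f) (linearP u) f0 uM).
by exists (Dual gP) => x /=; rewrite uphi.
Qed.

(** A complex functional f is recovered from its real part u by
    f y = u y - i u (i y), because Re (i f y) = - Im (f y). *)
Lemma complex_linear_of_real (R : realType) (Y : lmodType R[i])
    (u : {linear realified Y -> R^o}) :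
  linear (fun y : Y => (u y -i* u ('i *: y))%C : R[i]^o).
Proof.
move=> [a b] x y.
have uZ (c d : R) (z : Y) : u ((c +i* d)%C *: z) = c * u z + d * u ('i *: z).
  have -> : (c +i* d)%C *: z = ((c%:C)%C *: z + (d%:C)%C *: ('i%C *: z) : Y).
    by rewrite scalerA -scalerDl; congr (_ *: _); simpc.
  transitivity (u (c *: (z : realified Y) + d *: ('i%C *: z : realified Y))) => //.
  by rewrite linearD !linearZ.
have -> : 'i%C *: ((a +i* b)%C *: x + y) = (- b +i* a)%C *: x + 'i%C *: y.
  by rewrite scalerDr scalerA; simpc.
have uD (v w : Y) : u (v + w) = u v + u w by exact: linearD.
rewrite (uD ((a +i* b)%C *: x)) (uD ((- b +i* a)%C *: x)) (uZ a b x).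
rewrite (uZ (- b) a x) /GRing.scale /=; simpc.
by apply/eqP; rewrite eq_complex /=; apply/andP; split; apply/eqP; ring.
Qed.

Lemma dual_extension_complex (R : realType)
    (X Y : normedModType (ComplexScalars R)) (phi : {linear X -> Y}) :
  (forall x, `|x| <= `|phi x|) ->
  forall f : dual X, exists g : dual Y, forall x, g (phi x) = f x.
Proof.
move=> phi1 f; pose M : R := complex.Re (opnorm f).
have fM : opnorm f = (M%:C)%C.
  by have := opnorm_ge0 f; rewrite /M lecE; case: (opnorm f) => a b /= /andP[/eqP-> _].
have M0 : 0 <= M by have := opnorm_ge0 f; rewrite fM lecE /= => /andP[].
have phi_lin : linear (phi : realified X -> realified Y).
  by move=> t x y; exact: linearP.
pose j := HB.pack_for {linear realified X -> realified Y}
  (phi : realified X -> realified Y)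
  (GRing.isLinear.Build R (realified X) (realified Y) _ _ phi_lin).
have Re_lin : linear (fun x : realified X => complex.Re (f x) : R^o).
  move=> t x y.
  have -> : f (t *: x + y) = ((t%:C)%C * f x + f y :> R[i]).
    exact: (linearP f (t%:C)%C).
  rewrite raddfD; congr (_ + _).
  by case: (f x) => c d /=; rewrite mul0r subr0.
pose h := HB.pack_for {linear realified X -> R^o}
  (fun x : realified X => complex.Re (f x) : R^o)
  (GRing.isLinear.Build R (realified X) R^o _ _ Re_lin).
have [|u [up uphi]] := @hahn_banach_real R (realified Y) (realified X) j h
  _ (@norm_sublinear_complex R Y M M0).
  move=> x; have := le_trans (opnormP f x) (ler_wpM2l (opnorm_ge0 f) (phi1 x)).
  move=> /(le_trans (normc_ge_Re (f x))); rewrite fM lecE => /andP[_] /=.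
  move=> fx; rewrite (le_trans (ler_norm _))// (le_trans fx)//.
  by case: `|phi x| => a b /=; rewrite mul0r subr0.
have uM y : `|u y| <= M * complex.Re `|y : Y|.
  rewrite ler_norml up andbT lerNl -linearN (le_trans (up _))//.
  by rewrite (normrN (y : Y)).
(* The factor two comes from bounding real and imaginary parts separately;
   only continuity of the extension matters, not its norm. *)
have gM y : `|(u y -i* u ('i%C *: y))%C : R[i]| <= ((M + M)%:C)%C * `|y : Y|.
  have norm_real (z : R[i]) : 0 <= z -> z = ((complex.Re z)%:C)%C.
    by case: z => a b; rewrite lecE /= => /andP[/eqP->].
  have norm_Re_Im (a b : R) : `|(a +i* b)%C| <= ((`|a| + `|b|)%:C)%C.
    rewrite normc_def lecR /= -[leRHS]ger0_norm ?addr_ge0// -sqrtr_sqr.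
    rewrite ler_wsqrtr// sqrrD !real_normK ?num_real// lerD2r lerDl.
    by rewrite mulrn_wge0// mulr_ge0.
  apply: (le_trans (norm_Re_Im _ _)).
  rewrite (norm_real `|y|)// -rmorphM lecR mulrDl lerD// normrN.
  by rewrite (le_trans (uM _))// normrZ normc_def /= expr0n expr1n add0r sqrtr1 mul1r.
have gP := @bounded_linear_dual (ComplexScalars R) Y _ _
  (complex_linear_of_real u) _ gM.
have {}gP := gP ltac:(by rewrite lecR addr_ge0).
exists (Dual gP) => x /=.
have ufi : u ('i%C *: phi x) = complex.Re ('i%C * f x).
  have := uphi ('i%C *: x); rewrite /= [phi _]linearZ.
  by rewrite [f _]linearZ.
rewrite ufi uphi /=; case: (f x) => a b /=.
by rewrite mul0r mul1r sub0r opprK.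
Qed.

(** This is surjectivity of the adjoint of an embedding that does not decrease
    norms, the form in which the Hahn-Banach theorem is used below. *)
Theorem dual_extension (F : scalars) (X Y : normedModType F)
    (phi : {linear X -> Y}) : (forall x, `|x| <= `|phi x|) ->
  forall f : dual X, exists g : dual Y, forall x, g (phi x) = f x.
Proof.
case: F X Y phi => R; [exact: dual_extension_real|exact: dual_extension_complex].
Qed.

(** * Naturality of the Arens products *)

Section DualMap.
Variables (F : scalars) (X Y : normedModType F) (phi : {linear X -> Y}).
Hypothesis cphi : continuous phi.

Lemma dual_map_subproof (g : dual Y) : (fun x => g (phi x)) \in @dual_pred F X.
Proof.
apply/asboolP; split=> [a x y|x]; first by rewrite !linearP.
apply: (@continuous_comp X Y F^o phi g); first exact: cphi.
exact: (@dual_continuous F Y g).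
Qed.

Definition dual_map (g : dual Y) : dual X := Dual (dual_map_subproof g).

Lemma dual_map_linear : linear dual_map.
Proof. by move=> a f g; apply: val_inj; apply/funext. Qed.

HB.instance Definition _ :=
  GRing.isLinear.Build F (dual Y) (dual X) _ dual_map dual_map_linear.

Lemma dual_map_continuous : continuous dual_map.
Proof.
have /linear_bounded_continuous/linear_boundedP/pinfty_ex_gt0[M M0 phiM] := cphi.
apply: (@linear_bounded_continuous _ _ _ dual_map).1; apply/linear_boundedP.
exists M; split=> [|r /ltW Mr g]; first exact: gtr0_real.
apply: opnorm_le => [|x]; first by rewrite mulr_ge0// (le_trans (ltW M0)).
rewrite (le_trans (opnormP g (phi x)))// [r * _]mulrC -mulrA.
rewrite ler_wpM2l ?opnorm_ge0// (le_trans (phiM x))//.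
by rewrite ler_wpM2r.
Qed.

End DualMap.

Definition bidual_map (F : scalars) (X Y : normedModType F)
    (phi : {linear X -> Y}) (cphi : continuous phi) :
  dual (dual X) -> dual (dual Y) := dual_map (@dual_map_continuous _ _ _ phi cphi).

(** Evaluated at g, both sides are
    x'' (x |-> y'' (y |-> g (theta (m x y)))). *)
Lemma triadjoint_natural (F : scalars) (X Y Z X1 Y1 Z1 : normedModType F)
    (m : bbilinear X Y Z) (m1 : bbilinear X1 Y1 Z1)
    (phi : {linear X -> X1}) (psi : {linear Y -> Y1}) (theta : {linear Z -> Z1})
    (cphi : continuous phi) (cpsi : continuous psi) (ctheta : continuous theta) :
  (forall x y, m1 (phi x) (psi y) = theta (m x y)) ->
  forall x'' y'', triadjoint m1 (bidual_map cphi x'') (bidual_map cpsi y'') =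
    bidual_map ctheta (triadjoint m x'' y'').
Proof.
move=> mE x'' y''; apply: val_inj; apply/funext => g /=.
congr (x'' _); apply: val_inj; apply/funext => x /=.
congr (y'' _); apply: val_inj; apply/funext => y /=.
by rewrite mE.
Qed.

(** By naturality for m and for its transpose, the two extensions of m agree on
    the functionals g o theta, and by hypothesis every functional on Z has this
    form. *)
Lemma arens_regular_map_pullback (F : scalars)
    (X Y Z X1 Y1 Z1 : normedModType F)
    (m : bbilinear X Y Z) (m1 : bbilinear X1 Y1 Z1)
    (phi : {linear X -> X1}) (psi : {linear Y -> Y1}) (theta : {linear Z -> Z1}) :
  continuous phi -> continuous psi -> continuous theta ->
  (forall x y, m1 (phi x) (psi y) = theta (m x y)) ->
  (forall f : dual Z, exists g : dual Z1, forall z, g (theta z) = f z) ->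
  arens_regular_map m1 -> arens_regular_map m.
Proof.
move=> cphi cpsi ctheta mE ext reg x'' y''.
apply: val_inj; apply/funext => f /=.
have [g gf] := ext f; have -> : f = dual_map ctheta g.
  by apply: val_inj; apply/funext => z; rewrite /= gf.
have mtE y x : transpose m1 (psi y) (phi x) = theta (transpose m y x) := mE x y.
have := reg (bidual_map cphi x'') (bidual_map cpsi y'').
rewrite (triadjoint_natural cphi cpsi ctheta mE) /= /transpose_fun.
rewrite (triadjoint_natural cpsi cphi ctheta mtE).
by move=> /(congr1 (fun G => val G g)).
Qed.

Lemma arens_regular_embedding (F : scalars) (A T : banachAlgType F)
    (phi : {linear A -> T}) : continuous phi ->
  (forall a b, phi (bmul a b) = bmul (phi a) (phi b)) ->
  (forall a, `|a| <= `|phi a|) -> arens_regular T -> arens_regular A.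
Proof.
move=> cphi phiM phi1.
apply: (arens_regular_map_pullback cphi cphi cphi); last exact: dual_extension.
by move=> a b /=; rewrite phiM.
Qed.

(** * Elementary tensors in the projective tensor product *)

Section ElementaryTensors.
Variables (F : scalars) (A B T : banachAlgType F).
Variable tau : {bilinear A -> B -> T}.
Hypothesis tauT : is_projective_tensor tau.

Lemma norm_elementary_tensor a b : `|tau a b| <= `|a| * `|b|.
Proof.
have ab : tensor_sum tau [:: (a, b)] = tau a b by rewrite /tensor_sum big_seq1.
have [lb _] := ptensor_norm tauT (ex_intro2 _ _ [:: (a, b)] I ab).
by apply: lb; exists [:: (a, b)] => //; rewrite /tensor_cost big_seq1.
Qed.

(** If a (x) b is the sum of the a_i (x) b_i, then f a b is the sum of the
    f a_i b_i, by the universal property applied to the vanishing sum with the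
    extra term (- a) (x) b.  Hence the norm of f a b is a lower bound of the
    costs whose infimum is the projective norm. *)
Lemma elementary_tensor_lower_bound (V : normedModType F)
    (f : {bilinear A -> B -> V}) : (forall a b, `|f a b| <= `|a| * `|b|) ->
  forall a b, `|f a b| <= `|tau a b|.
Proof.
move=> f1 a b.
have ab : tensor_sum tau [:: (a, b)] = tau a b by rewrite /tensor_sum big_seq1.
have [_] := ptensor_norm tauT (ex_intro2 _ _ [:: (a, b)] I ab).
apply=> _ [s /= sab <-].
have : tensor_sum tau ((- a, b) :: s) = 0.
  rewrite /tensor_sum big_cons /= linearNl -/(tensor_sum tau s) sab.
  by rewrite addNr.
move=> /(ptensor_algebraic tauT f).
rewrite /tensor_sum big_cons /= linearNl => /eqP.
rewrite addrC subr_eq0 => /eqP <-.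
apply: (le_trans (ler_norm_sum _ _ _)); apply: ler_sum => p _; exact: f1.
Qed.

End ElementaryTensors.

Section TwistedProduct.
Variables (F : scalars) (A B : banachAlgType F) (iota : {linear A -> B}).

Definition bmul_along (a : A) (b : B) : B := bmul (iota a) b.

Lemma bmul_along_bilinear :
  bilinear_for (GRing.Scale.Law.clone _ _ *:%R _)
    (GRing.Scale.Law.clone _ _ *:%R _) bmul_along.
Proof.
split=> u a x y; rewrite /bmul_along; last by rewrite bmulDr bmulZr.
by rewrite linearP bmulDl bmulZl.
Qed.

HB.instance Definition _ :=
  bilinear_isBilinear.Build F A B B _ _ bmul_along bmul_along_bilinear.

End TwistedProduct.

(** * Arens irregularity of the projective tensor product *)

Theorem mainTheorem2 (F : scalars) (A B : banachAlgType F)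
    (iota : {linear A -> B}) (T : banachAlgType F)
    (tau : {bilinear A -> B -> T}) :
  unital B ->
  subalgebra_embedding iota ->
  is_projective_tensor tau ->
  ~ arens_regular A ->
  ~ arens_regular T.
Proof.
move=> [e eP] [_ iota_norm] tauT; apply: contra_not.
have phi_lin : linear (fun a => tau a e) by move=> k a b; rewrite linearPl.
pose phi := HB.pack_for {linear A -> T} (fun a => tau a e)
  (GRing.isLinear.Build F A T _ _ phi_lin).
apply: (@arens_regular_embedding F A T phi) => [|a b|a].
- apply: (@linear_bounded_continuous F A T phi).1; apply/linear_boundedP.
  exists `|e|; split=> // r /ltW er a.
  rewrite (le_trans (norm_elementary_tensor tauT a e))// mulrC.
  by rewrite ler_wpM2r.
- by rewrite /= (ptensor_mul tauT) (eP e).1.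
- rewrite -iota_norm -[iota a](eP _).2.
  apply: (@elementary_tensor_lower_bound _ _ _ _ _ tauT B (bmul_along iota)).
  by move=> b c; rewrite (le_trans (bmul_norm _ _))// iota_norm.
Qed.
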